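(* Let $\mathfrak{B}$ be a bornology on a metric space $X$ with a closed base. Let the ideal $\mathcal{I}$ on $\omega$ have a pseudounion. The following statements are equivalent. (1) $X$ has the $\mathcal{I}$-$\mathfrak{B}^s$-Hurewicz property. (2) $X$ has the $\mathfrak{B}^s$-Hurewicz property. (3) $X$ satisfies $\mathrm{S}_{\mathrm{fin}}(\mathcal{O}_{\mathfrak{B}^s},\mathcal{I}\text{-}\mathcal{O}_{\mathfrak{B}^s}^{gp})$. (4) $X$ satisfies $\mathrm{S}_{\mathrm{fin}}(\mathcal{O}_{\mathfrak{B}^s},\mathcal{O}_{\mathfrak{B}^s}^{gp})$. (5) ONE has no winning strategy in the $\mathcal{I}$-$\mathfrak{B}^s$-Hurewicz game. (6) ONE has no winning strategy in the $\mathfrak{B}^s$-Hurewicz game. (7) ONE has no winning strategy in the game $\mathrm{G}_{\mathrm{fin}}(\mathcal{O}_{\mathfrak{B}^s},\mathcal{I}\text{-}\mathcal{O}_{\mathfrak{B}^s}^{gp})$. (8) ONE has no winning strategy in the game $\mathrm{G}_{\mathrm{fin}}(\mathcal{O}_{\mathfrak{B}^s},\mathcal{O}_{\mathfrak{B}^s}^{gp})$.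
   Context: $(X,d)$ is an infinite metric space; $\omega$ is the set of natural numbers. A bornology $\mathfrak{B}$ on $X$ is a family of subsets of $X$ that is closed under subsets and finite unions and covers $X$. A base of $\mathfrak{B}$ is a subfamily $\mathfrak{B}_0\subseteq\mathfrak{B}$ such that every $B\in\mathfrak{B}$ is contained in some $B_0\in\mathfrak{B}_0$; it is a closed base if its members are closed. For $B\in\mathfrak{B}$, $\delta>0$: $B^\delta=\bigcup_{x\in B}\{y\in X:d(x,y)<\delta\}$. An ideal on $\omega$ is a family $\mathcal{I}\subseteq\mathcal{P}(\omega)$ closed under subsets and finite unions, containing all finite sets, with $\omega\notin\mathcal{I}$. A set $A\subseteq\omega$ is a pseudounion of $\mathcal{I}$ if $\omega\setminus A$ is infinite and $I\setminus A$ is finite for every $I\in\mathcal{I}$. Covers of $X$ never contain $X$ as an element. A cover $\mathcal{U}$ of $X$ by open sets is an open $\mathfrak{B}^s$-cover if for each $B\in\mathfrak{B}$ there are $U\in\mathcal{U}$ and $\delta>0$ with $B^\delta\subseteq U$; $\mathcal{O}_{\mathfrak{B}^s}$ is the class of these. For a sequence $\{\mathcal{V}_n:n\in\omega\}$ of finite families of open sets consider two conditions. (H) For every $B\in\mathfrak{B}$ there are $n_0\in\omega$ and positive reals $\delta_n$ ($n\geq n_0$) such that for all $n\geq n_0$, $B^{\delta_n}\subseteq U$ for some $U\in\mathcal{V}_n$. ($\mathcal{I}$H) For every $B\in\mathfrak{B}$ there is a sequence $\{\delta_n\}$ of positive reals with $\{n\in\omega:\text{there is no }U\in\mathcal{V}_n\text{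 with }B^{\delta_n}\subseteq U\}\in\mathcal{I}$. $X$ has the $\mathfrak{B}^s$-Hurewicz property (resp. $\mathcal{I}$-$\mathfrak{B}^s$-Hurewicz property) if for each sequence $\{\mathcal{U}_n\}$ of open $\mathfrak{B}^s$-covers of $X$ there are finite $\mathcal{V}_n\subseteq\mathcal{U}_n$ such that $\{\mathcal{V}_n\}$ satisfies (H) (resp. ($\mathcal{I}$H)). In the $\mathfrak{B}^s$-Hurewicz game (resp. $\mathcal{I}$-$\mathfrak{B}^s$-Hurewicz game) on $X$, in the $n$-th inning ONE chooses an open $\mathfrak{B}^s$-cover $\mathcal{U}_n$ of $X$ and then TWO chooses a finite $\mathcal{V}_n\subseteq\mathcal{U}_n$; TWO wins if $\{\mathcal{V}_n\}$ satisfies (H) (resp. ($\mathcal{I}$H)), otherwise ONE wins. An open cover $\mathcal{U}$ of $X$ is $\mathfrak{B}^s$-groupable (resp. $\mathcal{I}$-$\mathfrak{B}^s$-groupable) if $\mathcal{U}=\bigcup_{n\in\omega}\mathcal{U}_n$ for a sequence $\{\mathcal{U}_n\}$ of finite pairwise disjoint families satisfying (H) (resp. ($\mathcal{I}$H)). $\mathcal{O}_{\mathfrak{B}^s}^{gp}$ (resp. $\mathcal{I}\text{-}\mathcal{O}_{\mathfrak{B}^s}^{gp}$) is the class of open $\mathfrak{B}^s$-groupable (resp. $\mathcal{I}$-$\mathfrak{B}^s$-groupable) covers of $X$. $\mathrm{S}_{\mathrm{fin}}(\mathcal{A},\mathcal{B})$: for every sequence $\{A_n\}$ of elements of $\mathcal{A}$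 there are finite (possibly empty) sets $B_n\subseteq A_n$ with $\bigcup_nB_n\in\mathcal{B}$. $\mathrm{G}_{\mathrm{fin}}(\mathcal{A},\mathcal{B})$: the infinite game in which in the $n$-th round ONE chooses $A_n\in\mathcal{A}$ and then TWO chooses a finite (possibly empty) $B_n\subseteq A_n$; TWO wins if $\bigcup_nB_n\in\mathcal{B}$, otherwise ONE wins. *)

(* Defs.v *)
From HB Require Import structures.
From mathcomp Require Import all_boot all_order all_algebra.
From mathcomp Require Import all_classical all_reals all_analysis.

Set Implicit Arguments.
Unset Strict Implicit.
Unset Printing Implicit Defensive.

Import Order.TTheory GRing.Theory Num.Theory.

Local Open Scope classical_set_scope.
Local Open Scope ring_scope.

Definition is_ideal (I : set (set nat)) : Prop :=
  [/\ forall A B, A `<=` B -> I B -> I A,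
      forall A B, I A -> I B -> I (A `|` B),
      forall A, finite_set A -> I A &
      ~ I [set: nat]].

Definition pseudounion (I : set (set nat)) (A : set nat) : Prop :=
  infinite_set (~` A) /\ forall J, I J -> finite_set (J `\` A).

Definition bornology (T : Type) (BB : set (set T)) : Prop :=
  [/\ forall A B, A `<=` B -> BB B -> BB A,
      forall A B, BB A -> BB B -> BB (A `|` B) &
      \bigcup_(B in BB) B = [set: T]].

Definition bornology_base (T : Type) (BB BB0 : set (set T)) : Prop :=
  BB0 `<=` BB /\ forall B, BB B -> exists2 B0, BB0 B0 & B `<=` B0.

Definition closed_base (T : topologicalType) (BB BB0 : set (set T)) : Prop :=
  bornology_base BB BB0 /\ BB0 `<=` closed.

Definition Sfin (T : Type) (AA BB : set (set T)) : Prop :=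
  forall A : nat -> set T, (forall n, AA (A n)) ->
  exists B : nat -> set T,
    (forall n, finite_set (B n) /\ B n `<=` A n) /\ BB (\bigcup_n B n).

(* Games in which, in inning [n], ONE chooses a member of [AA] and TWO answers
   with a finite subset of it; [win V] says that TWO wins the play in which
   the answers are [V 0, V 1, ...].  A strategy of ONE maps the finite sequence
   of the answers made so far to ONE's next choice. *)
Definition compatible_play (T : Type) (sigma : seq (set T) -> set T)
    (V : nat -> set T) : Prop :=
  forall n, finite_set (V n) /\ V n `<=` sigma (mkseq V n).

(* TWO may always answer [set0], so every legal finite sequence of answers
   extends to a compatible play: quantifying over compatible plays requires
   [sigma] to make a legal choice at every position it can reach. *)
Definition ONE_strategy (T : Type) (AA : set (set T))
    (sigma : seq (set T) -> set T) : Prop :=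
  forall V, compatible_play sigma V -> forall n, AA (sigma (mkseq V n)).

Definition ONE_has_winning_strategy (T : Type) (AA : set (set T))
    (win : (nat -> set T) -> Prop) : Prop :=
  exists sigma, ONE_strategy AA sigma /\
    forall V, compatible_play sigma V -> ~ win V.

Definition Gfin_win (T : Type) (BB : set (set T)) (V : nat -> set T) : Prop :=
  BB (\bigcup_n V n).

Section BornologicalCovers.
Context {R : realType} {X : metricType R}.
Implicit Types (BB : set (set X)) (I : set (set nat)) (U : set (set X))
  (V : nat -> set (set X)).

Definition enlargement (B : set X) (delta : R) : set X :=
  \bigcup_(x in B) [set y | mdist x y < delta].

Definition open_cover U : Prop :=
  [/\ U `<=` open, \bigcup_(u in U) u = [set: X] & ~ U [set: X]].

Definition open_Bs_cover BB : set (set (set X)) :=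
  [set U | open_cover U /\
    forall B, BB B -> exists u (delta : R),
      [/\ U u, 0 < delta & enlargement B delta `<=` u]].

Definition condH BB V : Prop :=
  forall B, BB B -> exists (n0 : nat) (delta : nat -> R),
    forall n, (n0 <= n)%N ->
      0 < delta n /\ exists2 u, V n u & enlargement B (delta n) `<=` u.

Definition condIH I BB V : Prop :=
  forall B, BB B -> exists delta : nat -> R,
    (forall n, 0 < delta n) /\
    I [set n | ~ exists2 u, V n u & enlargement B (delta n) `<=` u].

Definition hurewicz_selection BB (C : (nat -> set (set X)) -> Prop) : Prop :=
  forall U : nat -> set (set X), (forall n, open_Bs_cover BB (U n)) ->
  exists V : nat -> set (set X),
    (forall n, finite_set (V n) /\ V n `<=` U n) /\ C V.

Definition Bs_Hurewicz BB : Prop := hurewicz_selection BB (condH BB).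

Definition I_Bs_Hurewicz I BB : Prop := hurewicz_selection BB (condIH I BB).

Definition groupable_by (C : (nat -> set (set X)) -> Prop) U : Prop :=
  exists W : nat -> set (set X),
    [/\ U = \bigcup_n W n, forall n, finite_set (W n),
        trivIset [set: nat] W & C W].

Definition Bs_groupable BB : set (set (set X)) :=
  [set U | open_cover U /\ groupable_by (condH BB) U].

Definition I_Bs_groupable I BB : set (set (set X)) :=
  [set U | open_cover U /\ groupable_by (condIH I BB) U].

End BornologicalCovers.

(* Main.v *)
Require Import Defs.
From mathcomp Require Import all_boot all_order all_algebra.
From mathcomp Require Import all_classical all_reals all_analysis.

(** Write [captures U B] when some member of the family [U] contains an
    enlargement of [B].  Condition (H) says that, for each bounded [B], all but
    finitely many terms of the sequence capture [B]; condition (IH) says that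
    the exceptional indices form a member of the ideal.  Hence (H) implies (IH),
    and (IH) becomes (H) along any injective sequence of indices avoiding a
    pseudounion [A]: such a sequence meets each member of the ideal finitely
    often ([condIH_avoiding]).  All equivalences between a property and its
    ideal version come from these two remarks.

    A selection principle follows from the corresponding game, since a given
    sequence of covers is a strategy of ONE that ignores TWO's answers
    ([no_winning_strategy_selection]).  Three arguments carry the rest.

    - From the Hurewicz property to the game ([hurewicz_game]).  Applied to a
      constant sequence, the property exhausts each cover by an increasing
      sequence of finite subfamilies whose union is still a cover of the same
      kind.  Restricting TWO to these subfamilies makes the tree of positions
      countable, so the property applies to all the covers of the tree at once:
      it gives one answer at each position, and each [B] is captured at all but
      finitely many positions.  The branch along which TWO gives these answers
      is a play that TWO wins.

    - From the Hurewicz game to the groupable game ([groupable_game]).  Removing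
      finitely many sets from an open [B^s]-cover leaves an open [B^s]-cover
      ([open_Bs_coverD]), so ONE may withhold the sets already chosen by TWO.
      TWO's answers are then pairwise disjoint, and witness by themselves that
      their union is groupable.

    - From groupable selections back to the Hurewicz property
      ([Sfin_groupable_hurewicz]).  After replacing the [n]-th cover by the
      common refinement of the first ones, only finitely many selected sets fail
      to refine the [n]-th cover; disjoint groups meet those only finitely
      often, so a late enough group refines the [n]-th cover as a whole. *)

Set Implicit Arguments.
Unset Strict Implicit.

Import Order.TTheory.

Local Open Scope classical_set_scope.

(** * Finite sets *)

Lemma finite_nat_bounded (A : set nat) :
  finite_set A -> exists N, forall n, A n -> (n < N)%N.
Proof.
move=> /finite_seqP[s ->]; exists (\max_(i <- s) i).+1 => n /= sn.
by rewrite ltnS; exact: leq_bigmax_seq.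
Qed.

Lemma bigcup_nondecreasing_finite_sub (T : Type) (F : nat -> set T)
    (G : set T) :
  (forall k l, (k <= l)%N -> F k `<=` F l) ->
  finite_set G -> G `<=` \bigcup_k F k -> exists k, G `<=` F k.
Proof.
move=> Fmono Gfin GF.
have /choice[h hF] : forall w, exists k, G w -> F k w.
  move=> w; case: (pselect (G w)) => [/GF[k _ Fkw]|nGw]; first by exists k.
  by exists 0%N.
have [N hN] := finite_nat_bounded (finite_image h Gfin).
exists N => w Gw; apply: Fmono (hF _ Gw).
by apply: ltnW; apply: hN; exists w.
Qed.

(** Each point of [F] lies in at most one [W k]. *)
Lemma trivIset_eventually_disjoint (T : Type) (W : nat -> set T) (F : set T) :
  trivIset [set: nat] W -> finite_set F ->
  exists N, forall k, (N <= k)%N -> forall w, W k w -> ~ F w.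
Proof.
move=> Wtriv Ffin.
have [|N KN] := @finite_nat_bounded (\bigcup_(w in F) [set k | W k w]).
  apply: bigcup_finite => // w _.
  case: (pselect (exists k, W k w)) => [[k Wkw]|nW].
    apply: (@sub_finite_set _ _ [set k]) => // l Wlw /=.
    by apply: Wtriv => //; exists w.
  by apply: (@sub_finite_set _ _ set0) => // l Wlw; apply: nW; exists l.
exists N => k Nk w Wkw Fw.
by have := KN k; rewrite ltnNge Nk => /(_ _)/negP; apply=> //; exists w.
Qed.

(** * Plays along the branches of a tree *)

(** TWO is restricted to the countably many answers [F U 0], [F U 1], ... to
    each choice [U] of ONE, so that positions are coded by sequences of natural
    numbers. *)
Section Tree.
Variables (T : Type) (sigma : seq (set T) -> set T).
Variable F : set T -> nat -> set T.

Definition position (s : seq nat) : seq (set T) :=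
  foldl (fun p k => rcons p (F (sigma p) k)) [::] s.

Definition branch_play (x : nat -> nat) (n : nat) : set T :=
  F (sigma (position (mkseq x n))) (x n).

Lemma mkseq_branch_play x n :
  mkseq (branch_play x) n = position (mkseq x n).
Proof. by elim: n => // n IHn; rewrite !mkseqS IHn /position foldl_rcons. Qed.

Hypothesis F_finite : forall U k, finite_set (F U k).
Hypothesis F_sub : forall U k, F U k `<=` U.

Lemma branch_play_compatible x : compatible_play sigma (branch_play x).
Proof.
move=> n; rewrite mkseq_branch_play.
by split; [exact: F_finite|exact: F_sub].
Qed.

Lemma position_legal (AA : set (set T)) s :
  ONE_strategy AA sigma -> AA (sigma (position s)).
Proof.
move=> sigmaP; have := sigmaP _ (branch_play_compatible (nth 0%N s)) (size s).
by rewrite mkseq_branch_play mkseq_nth.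
Qed.

End Tree.

(** The branch obtained by always moving to the successor chosen by [f]. *)
Lemma branch_following (f : seq nat -> nat) :
  exists x : nat -> nat, forall n, x n = f (mkseq x n).
Proof.
pose t := fix t n := if n is m.+1 then rcons (t m) (f (t m)) else [::].
exists (fun n => f (t n)) => n; congr f.
by elim: n => // n IHn; rewrite mkseqS -IHn.
Qed.

(** * Covers *)

Section Covers.
Context {R : realType} {X : metricType R}.
Implicit Types (B : set X) (BB U : set (set X)).

Definition captures U B : Prop :=
  exists u (delta : R), [/\ U u, (0 < delta)%R & enlargement B delta `<=` u].

Lemma captures_sub U V B : U `<=` V -> captures U B -> captures V B.
Proof. by move=> UV [u [d [Uu d0 Bu]]]; exists u, d; split=> //; exact: UV. Qed.

Lemma captures_enlargement V B (delta : R) : (0 < delta)%R ->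
  (exists2 u, V u & enlargement B delta `<=` u) -> captures V B.
Proof. by move=> d0 [u Vu Bu]; exists u, delta. Qed.

Lemma sub_enlargement B (delta : R) : (0 < delta)%R ->
  B `<=` enlargement B delta.
Proof. by move=> d0 x Bx; exists x => //=; rewrite mdistxx. Qed.

Lemma enlargement_le B (d e : R) : (d <= e)%R ->
  enlargement B d `<=` enlargement B e.
Proof. by move=> de y [x Bx /= xy]; exists x => //=; exact: lt_le_trans de. Qed.

Lemma enlargementS A B (d : R) : A `<=` B ->
  enlargement A d `<=` enlargement B d.
Proof. by move=> AB y [x Ax xy]; exists x => //; exact: AB. Qed.

(** Since a witness [delta n] can be chosen separately for each [n], condition
    (IH) only restricts the set of indices at which [B] is not captured. *)
Lemma condIHP (I : set (set nat)) BB (V : nat -> set (set X)) :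
  (forall J K, J `<=` K -> I K -> I J) ->
  condIH I BB V <-> forall B, BB B -> I [set n | ~ captures (V n) B].
Proof.
move=> Isub; split=> [VH B BB_B|VH B /VH IB].
  have [d [d0 Id]] := VH B BB_B; apply: Isub Id => n /= nV nE; apply: nV.
  exact: captures_enlargement nE.
have /choice[d dP] : forall n, exists d : R, (0 < d)%R /\
    (captures (V n) B -> exists2 u, V n u & enlargement B d `<=` u).
  move=> n; case: (pselect (captures (V n) B)) => [[u [d [Vu d0 Bu]]]|nc].
    by exists d; split=> // _; exists u.
  by exists 1%R; split.
exists d; split=> [n|]; first by have [] := dP n.
by apply: Isub IB => n /= nE c; apply: nE; have [_] := dP n; apply.
Qed.

(** Condition (H) is (IH) for the ideal of finite sets; the two definitions
    differ in where [delta] has to be positive. *)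
Lemma condH_condIH BB (V : nat -> set (set X)) :
  condH BB V <-> condIH finite_set BB V.
Proof.
split=> [VH B BB_B|VH B BB_B].
  have [n0 [d dP]] := VH B BB_B.
  exists (fun n => if (n0 <= n)%N then d n else 1%R); split=> [n|].
    by case: ifP => // /dP[].
  apply: (@sub_finite_set _ _ `I_n0) => [n /=|]; last exact: finite_II.
  by rewrite ltnNge => nE; apply/negP => n0n; apply: nE;
    rewrite n0n; have [] := dP n n0n.
have [d [d0 dfin]] := VH B BB_B; have [N NP] := finite_nat_bounded dfin.
exists N, d => n Nn; split=> //; apply: contrapT => nE.
by have := NP n nE; rewrite ltnNge Nn.
Qed.

Lemma condHP BB (V : nat -> set (set X)) :
  condH BB V <-> forall B, BB B -> finite_set [set n | ~ captures (V n) B].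
Proof.
rewrite condH_condIH; apply: condIHP => J K JK; exact: sub_finite_set.
Qed.

Lemma condH_imp_condIH (I : set (set nat)) BB (V : nat -> set (set X)) :
  is_ideal I -> condH BB V -> condIH I BB V.
Proof.
move=> [Isub _ Ifin _] /condHP VH; apply/condIHP => // B BB_B.
exact/Ifin/VH.
Qed.

Lemma condH_captures BB (V : nat -> set (set X)) :
  condH BB V -> forall B, BB B -> exists n, captures (V n) B.
Proof.
move=> VH B /VH[n [d dP]]; have [d0 Vd] := dP n (leqnn n).
by exists n; exact: captures_enlargement Vd.
Qed.

(** The set of bad indices of [V \o a] is the preimage under [a] of the part
    outside [A] of a member of [I], hence of a finite set. *)
Lemma condIH_avoiding (I : set (set nat)) BB (V : nat -> set (set X))
    (A : set nat) (a : nat -> nat) :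
  is_ideal I -> (forall J, I J -> finite_set (J `\` A)) ->
  injective a -> (forall n, ~ A (a n)) ->
  condIH I BB V -> condH BB (V \o a).
Proof.
move=> [Isub _ _ _] IA ainj aA /condIHP-/(_ Isub) VI.
apply/condHP => B /VI /IA Bfin.
apply: sub_finite_set (finite_preimage (f := a) _ Bfin) => [n|m n _ _] /=.
  by move=> nc; split.
exact: ainj.
Qed.

Lemma pseudounion_avoiding (I : set (set nat)) (A : set nat) :
  pseudounion I A ->
  exists2 a : nat -> nat, injective a & forall n, ~ A (a n).
Proof.
move=> [/infiniteP/pcard_leP[a] _]; exists a => [m n amn|n].
  by apply: (@inj _ _ _ a); rewrite ?inE.
exact: (@funS _ _ _ _ a).
Qed.

(** The cover [U n] is presented at the index [a n], where [a] avoids the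
    pseudounion, and the answer to [U n] is read off at that index. *)
Lemma I_hurewicz_imp_hurewicz (I : set (set nat)) BB :
  is_ideal I -> (exists A, pseudounion I A) ->
  I_Bs_Hurewicz I BB -> Bs_Hurewicz BB.
Proof.
move=> Iid [A AP] H U UO; have [a ainj aA] := pseudounion_avoiding AP.
have /choice[g gP] : forall m, exists n, forall k, a k = m -> k = n.
  move=> m; case: (pselect (exists k, a k = m)) => [[k <-]|nk].
    by exists k => l /ainj.
  by exists 0%N => k ak; case: nk; exists k.
have ga n : g (a n) = n by rewrite -(gP _ _ erefl).
have [V [VU VH]] := H (U \o g) (fun n => UO (g n)).
exists (V \o a); split; last exact: condIH_avoiding AP.2 _ _ VH.
by move=> n; have := VU (a n); rewrite /= ga.
Qed.

Section Bornology.
Variable BB : set (set X).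
Hypothesis BBb : bornology BB.

Let BBsub A B : A `<=` B -> BB B -> BB A.
Proof. by case: BBb => + _ _; apply. Qed.

Let BBU A B : BB A -> BB B -> BB (A `|` B).
Proof. by case: BBb => _ + _; apply. Qed.

Let BB1 x : BB [set x].
Proof.
have [B BB_B Bx] : (\bigcup_(B in BB) B) x by case: BBb => _ _ ->.
by apply: BBsub BB_B => y ->.
Qed.

Lemma captures_open_Bs_cover U :
  U `<=` open -> ~ U [set: X] -> (forall B, BB B -> captures U B) ->
  open_Bs_cover BB U.
Proof.
move=> Uop UX Uc; split=> //; split=> //; apply/seteqP; split=> // x _.
have [u [d [Uu d0 xu]]] := Uc _ (BB1 x).
by exists u => //; apply: xu; apply: sub_enlargement.
Qed.

Lemma open_Bs_cover_sub U V : open_Bs_cover BB U -> V `<=` U ->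
  (forall B, BB B -> captures V B) -> open_Bs_cover BB V.
Proof.
move=> [[Uop _ UX] _] VU Vc.
apply: captures_open_Bs_cover => //; first exact: subset_trans VU Uop.
by move=> /VU.
Qed.

Lemma open_Bs_cover_bigcup (U V : nat -> set (set X)) :
  (forall n, open_Bs_cover BB (U n)) -> (forall n, V n `<=` U n) ->
  (forall B, BB B -> exists n, captures (V n) B) ->
  open_Bs_cover BB (\bigcup_n V n).
Proof.
move=> UO VU Vc; apply: captures_open_Bs_cover.
- by move=> u [n _ /VU]; case: (UO n) => -[+ _ _] _; apply.
- by move=> [n _ /VU]; case: (UO n) => -[].
- move=> B /Vc[n]; apply: captures_sub => u Vu; by exists n.
Qed.

(** A point outside each [u] in [F] is added to [B]; finitely many points do not
    leave the bornology. *)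
Lemma bornology_escape_finite F B : finite_set F -> ~ F [set: X] -> BB B ->
  exists C, [/\ BB C, B `<=` C & forall u, F u -> ~ C `<=` u].
Proof.
move=> /finite_seqP[s ->]; elim: s => [|v s IHs] nX BB_B.
  by exists B; split=> // u; rewrite /= in_nil.
have [|C [BB_C BC Cs]] := IHs _ BB_B.
  by move=> /= Xs; apply: nX; rewrite /= inE Xs orbT.
have [x nvx] : exists x, ~ v x.
  apply: contrapT => /forallNP nv; apply: nX; rewrite /= inE.
  apply/orP; left; apply/eqP/esym/seteqP; split=> // x _.
  exact: contrapT (nv x).
exists (C `|` [set x]); split=> [||u]; first exact: BBU.
  by move=> y /BC; left.
rewrite /= inE => /orP[/eqP-> /(_ x) vx|us Cu].
  by apply: nvx; apply: vx; right.
by apply: (Cs u us) => y Cy; apply: Cu; left.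
Qed.

(** The member of [U] that captures the larger set [C] of
    [bornology_escape_finite] cannot belong to [F], and it captures [B]. *)
Lemma open_Bs_coverD U F : open_Bs_cover BB U -> finite_set F -> ~ F [set: X] ->
  open_Bs_cover BB (U `\` F).
Proof.
move=> UO Ffin FX; apply: (open_Bs_cover_sub UO) => [u []//|B BB_B].
have [_ Uc] := UO.
have [C [BB_C BC CF]] := bornology_escape_finite Ffin FX BB_B.
have [u [d [Uu d0 Cu]]] := Uc C BB_C.
exists u, d; split=> //; last exact: subset_trans (enlargementS BC) Cu.
by split=> // /CF; apply; exact: subset_trans (sub_enlargement d0) Cu.
Qed.

Definition meet_cover U (V : set (set X)) : set (set X) :=
  [set u `&` v | u in U & v in V].

Lemma open_Bs_cover_meet U V : open_Bs_cover BB U -> open_Bs_cover BB V ->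
  open_Bs_cover BB (meet_cover U V).
Proof.
move=> [[Uop _ UX] Uc] [[Vop _ _] Vc]; apply: captures_open_Bs_cover.
- by move=> _ [u Uu [v Vv <-]]; apply: openI; [exact: Uop|exact: Vop].
- move=> [u Uu [v Vv uvX]]; apply: UX; suff <- : u = [set: X] by [].
  apply/seteqP; split=> // x _.
  by have : [set: X] x by []; rewrite -uvX => -[].
- move=> B BB_B.
  have [u [d [Uu d0 Bu]]] := Uc B BB_B; have [v [e [Vv e0 Bv]]] := Vc B BB_B.
  exists (u `&` v), (Order.min d e); split; first by exists u => //; exists v.
    by rewrite lt_min d0 e0.
  rewrite subsetI; split.
    by apply: subset_trans Bu; apply: enlargement_le; rewrite ge_min lexx.
  by apply: subset_trans Bv; apply: enlargement_le; rewrite ge_min lexx orbT.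
Qed.

Fixpoint common_refinement (U : nat -> set (set X)) (n : nat) : set (set X) :=
  if n is m.+1 then meet_cover (common_refinement U m) (U n) else U 0%N.

Lemma common_refinement_open_Bs_cover (U : nat -> set (set X)) n :
  (forall n, open_Bs_cover BB (U n)) ->
  open_Bs_cover BB (common_refinement U n).
Proof. by move=> UO; elim: n => //= n IHn; exact: open_Bs_cover_meet. Qed.

Lemma common_refinementP (U : nat -> set (set X)) m n w : (m <= n)%N ->
  common_refinement U n w -> exists2 u, U m u & w `<=` u.
Proof.
elim: n w => [|n IHn] w; first by rewrite leqn0 => /eqP -> Uw; exists w.
rewrite leq_eqVlt => /predU1P[->|mn] /= [v Rv [u Uu <-]].
  by exists u => // x [].
have [u' Uu' vu'] := IHn v mn Rv.
by exists u' => // x [/vu'].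
Qed.

(** * Selection and games *)

(** A Lindelof-type consequence, with the countable subcover already arranged in
    increasing finite pieces. *)
Lemma hurewicz_exhaustion U : Bs_Hurewicz BB -> open_Bs_cover BB U ->
  exists F : nat -> set (set X),
    [/\ forall k, finite_set (F k), forall k, F k `<=` U,
        forall k l, (k <= l)%N -> F k `<=` F l &
        open_Bs_cover BB (\bigcup_k F k)].
Proof.
move=> H UO; have [V [VU VH]] := H (fun=> U) (fun=> UO).
exists (fun k => \bigcup_(i < k) V i); split=> [k|k|k l kl|].
- by apply: bigcup_finite => [|i _]; [exact: finite_II|case: (VU i)].
- by move=> u [i _]; have [_] := VU i; apply.
- by move=> u [i /= ik Viu]; exists i => //=; exact: leq_trans kl.
- apply: open_Bs_cover_sub UO _ _ => [u [k _ [i _]]|B BB_B].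
    by have [_] := VU i; apply.
  have [n] := condH_captures VH BB_B; apply: captures_sub => u Vu.
  by exists n.+1 => //; exists n => /=.
Qed.

(** Condition (H) for the covers indexed by the tree of positions says that the
    chosen answers capture [B] at all but finitely many nodes; an infinite branch
    visits each node at most once, so (H) holds along it. *)
Lemma hurewicz_game : Bs_Hurewicz BB ->
  ~ ONE_has_winning_strategy (open_Bs_cover BB) (condH BB).
Proof.
move=> H [sigma [sigmaP sigma_win]].
have /choice[F FP] : forall U, exists F : nat -> set (set X),
    [/\ forall k, finite_set (F k), forall k, F k `<=` U,
        forall k l, (k <= l)%N -> F k `<=` F l &
        open_Bs_cover BB U -> open_Bs_cover BB (\bigcup_k F k)].
  move=> U; case: (pselect (open_Bs_cover BB U)) => UO.
    by have [F [? ? ? ?]] := hurewicz_exhaustion H UO; exists F.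
  by exists (fun=> set0); split=> // k *; exact: sub0set.
have Ffin U k : finite_set (F U k) by case: (FP U).
have Fsub U k : F U k `<=` U by case: (FP U).
pose C s := F (sigma (position sigma F s)).
have CO s : open_Bs_cover BB (\bigcup_k C s k).
  case: (FP (sigma (position sigma F s))) => _ _ _; apply.
  exact: position_legal.
pose node m : seq nat := odflt [::] (unpickle m).
have [V [VC VH]] := H (fun m => \bigcup_k C (node m) k) (fun m => CO (node m)).
have /choice[f fP] : forall s, exists k, V (pickle s) `<=` C s k.
  move=> s; have [Vfin Vsub] := VC (pickle s).
  apply: bigcup_nondecreasing_finite_sub Vfin _ => [k l|].
    by rewrite /C; case: (FP (sigma (position sigma F s))) => _ _ + _; apply.
  by move: Vsub; rewrite /node pickleK.
have [x xP] := branch_following f.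
apply: (sigma_win (branch_play sigma F x)); first exact: branch_play_compatible.
apply/condHP => B BB_B.
have Bfin := (condHP BB V).1 VH B BB_B.
pose a n := pickle (mkseq x n).
apply: sub_finite_set (finite_preimage (f := a) _ Bfin) => [n /= nc Vc|].
  apply: nc; apply: captures_sub Vc; rewrite /branch_play xP; exact: fP.
move=> m n _ _ /(pcan_inj pickleK)/(congr1 size).
by rewrite !size_mkseq.
Qed.

Definition fresh_strategy (sigma : seq (set (set X)) -> set (set X))
    (s : seq (set (set X))) : set (set X) :=
  sigma s `\` \bigcup_(i < size s) nth set0 s i.

Lemma fresh_strategy_mkseq sigma (V : nat -> set (set X)) n :
  fresh_strategy sigma (mkseq V n) =
  sigma (mkseq V n) `\` \bigcup_(i < n) V i.
Proof.
rewrite /fresh_strategy size_mkseq; congr (_ `\` _).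
by apply: eq_bigcupr => i /= ni; rewrite nth_mkseq.
Qed.

(** Against ONE's strategy [fresh_strategy sigma], TWO's answers are disjoint, so
    a play satisfying [C] is itself a grouping of its union. *)
Lemma groupable_game (C : (nat -> set (set X)) -> Prop) :
  (forall V, C V -> forall B, BB B -> exists n, captures (V n) B) ->
  ~ ONE_has_winning_strategy (open_Bs_cover BB) C ->
  ~ ONE_has_winning_strategy (open_Bs_cover BB)
      (Gfin_win [set U | open_cover U /\ groupable_by C U]).
Proof.
move=> Ccap noC [sigma [sigmaP sigma_win]]; apply: noC.
have compat V : compatible_play (fresh_strategy sigma) V ->
    compatible_play sigma V.
  move=> VP n; have [Vfin] := VP n; rewrite fresh_strategy_mkseq => Vsub.
  by split=> // u /Vsub[].
have VX V : compatible_play sigma V -> forall n, ~ V n [set: X].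
  move=> VP n /(proj2 (VP n)).
  by case: (sigmaP V VP n) => -[].
exists (fresh_strategy sigma).
split=> [V /compat VP n|V /[dup] VP /compat VQ CV].
  rewrite fresh_strategy_mkseq; apply: open_Bs_coverD.
  - exact: sigmaP.
  - by apply: bigcup_finite => [|i _]; [exact: finite_II|case: (VP i)].
  - by move=> [i _]; exact: VX.
apply: (sigma_win V VQ).
have VO : open_Bs_cover BB (\bigcup_n V n).
  apply: (open_Bs_cover_bigcup (sigmaP V VQ)) (Ccap V CV) => n.
  by case: (VQ n).
split; first by case: VO.
exists V; split=> //; first by move=> n; case: (VQ n).
have disj i j w : (i < j)%N -> V i w -> ~ V j w.
  move=> ij Viw /(proj2 (VP j)); rewrite fresh_strategy_mkseq => -[_]; apply.
  by exists i.
move=> i j _ _ [w [Viw Vjw]].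
by case: (ltngtP i j) => // ij; [case: (disj i j w)|case: (disj j i w)].
Qed.

(** With the groups [W] indexed through [a] one has (H), not only (IH), so one
    may pass to any late group [k n] with [n <= k n] and still have (H). *)
Lemma Sfin_groupable_hurewicz (I : set (set nat)) :
  is_ideal I -> (exists A, pseudounion I A) ->
  Sfin (open_Bs_cover BB) (I_Bs_groupable I BB) -> Bs_Hurewicz BB.
Proof.
move=> Iid [A AP] S U UO; have [a ainj aA] := pseudounion_avoiding AP.
have [D [DU [_ [W [DW Wfin Wtriv WI]]]]] :=
  S _ (fun n => common_refinement_open_Bs_cover n UO).
have WaH := condIH_avoiding Iid AP.2 ainj aA WI.
have Watriv : trivIset [set: nat] (W \o a).
  by move=> i j _ _ /(Wtriv _ _ Logic.I Logic.I)/ainj.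
have /choice[N NP] : forall n, exists N, forall k, (N <= k)%N ->
    forall w, W (a k) w -> ~ (\bigcup_(i < n) D i) w.
  move=> n; apply: (trivIset_eventually_disjoint Watriv).
  by apply: bigcup_finite => [|i _]; [exact: finite_II|case: (DU i)].
(* [N n] makes the group miss the early selections; [n] keeps (H). *)
pose k n := maxn n (N n).
have WU n w : W (a (k n)) w -> exists2 u, U n u & w `<=` u.
  move=> Ww; have : (\bigcup_n D n) w by rewrite DW; exists (a (k n)).
  move=> [m _ Dmw]; apply: (@common_refinementP U n m).
    rewrite leqNgt; apply/negP => mn.
    by apply: (NP n (k n) _ w Ww); [exact: leq_maxr|exists m].
  by have [_] := DU m; apply.
have /choice[g gP] : forall n, exists g : set X -> set X, forall w,
    W (a (k n)) w -> U n (g w) /\ w `<=` g w.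
  move=> n; suff /choice[g gP] : forall w, exists u : set X,
    W (a (k n)) w -> U n u /\ w `<=` u by exists g.
  move=> w; case: (pselect (W (a (k n)) w)) => [/WU[u Uu wu]|nW].
    by exists u.
  by exists w.
exists (fun n => g n @` W (a (k n))); split=> [n|B BB_B].
  split; first exact: finite_image.
  by move=> _ [w /gP[Uw _] <-].
have [n0 [d dP]] := WaH B BB_B; exists n0, (d \o k) => n n0n.
have [d0 [w Ww Bw]] := dP (k n) (leq_trans n0n (leq_maxl _ _)).
split=> //; exists (g n w); first by exists w.
by apply: subset_trans Bw _; case: (gP n w Ww).
Qed.

End Bornology.
End Covers.

Lemma no_winning_strategy_selection (T : Type) (AA : set (set T))
    (win : (nat -> set T) -> Prop) :
  ~ ONE_has_winning_strategy AA win ->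
  forall A : nat -> set T, (forall n, AA (A n)) ->
  exists V : nat -> set T,
    (forall n, finite_set (V n) /\ V n `<=` A n) /\ win V.
Proof.
move=> now A AAA; apply: contrapT => noV; apply: now.
exists (fun s => A (size s)); split=> // V VP winV.
apply: noV; exists V; split=> // n.
by have := VP n; rewrite size_mkseq.
Qed.

Lemma no_winning_strategy_mono (T : Type) (AA : set (set T))
    (win win' : (nat -> set T) -> Prop) : (forall V, win V -> win' V) ->
  ~ ONE_has_winning_strategy AA win -> ~ ONE_has_winning_strategy AA win'.
Proof.
move=> ww now [sigma [sigmaP nw]]; apply: now.
by exists sigma; split=> // V /nw + /ww.
Qed.

Theorem theorem4p5 (R : realType) (X : metricType R)
    (X_infinite : infinite_set [set: X])
    (BB : set (set X)) (BB_bornology : bornology BB)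
    (BB_closed_base : exists BB0 : set (set X), closed_base BB BB0)
    (I : set (set nat)) (I_ideal : is_ideal I)
    (I_pseudounion : exists A : set nat, pseudounion I A) :
  [<-> I_Bs_Hurewicz I BB;
       Bs_Hurewicz BB;
       Sfin (open_Bs_cover BB) (I_Bs_groupable I BB);
       Sfin (open_Bs_cover BB) (Bs_groupable BB);
       ~ ONE_has_winning_strategy (open_Bs_cover BB) (condIH I BB);
       ~ ONE_has_winning_strategy (open_Bs_cover BB) (condH BB);
       ~ ONE_has_winning_strategy (open_Bs_cover BB)
           (Gfin_win (I_Bs_groupable I BB));
       ~ ONE_has_winning_strategy (open_Bs_cover BB)
           (Gfin_win (Bs_groupable BB))].
Proof.
have HIH V : condH BB V -> condIH I BB V := condH_imp_condIH I_ideal.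
have gpI U : Bs_groupable BB U -> I_Bs_groupable I BB U.
  move=> [Uc [W [UW Wfin Wtriv WH]]]; split=> //.
  by exists W; split=> //; exact: HIH.
have P12 := I_hurewicz_imp_hurewicz I_ideal I_pseudounion (BB := BB).
have P26 := hurewicz_game BB_bornology.
have P65 := no_winning_strategy_mono (AA := open_Bs_cover BB) HIH.
have P51 : _ -> I_Bs_Hurewicz I BB :=
  no_winning_strategy_selection (win := condIH I BB).
have P68 : _ -> ~ ONE_has_winning_strategy _ (Gfin_win (Bs_groupable BB)) :=
  groupable_game BB_bornology (@condH_captures _ _ BB).
have P87 := no_winning_strategy_mono (AA := open_Bs_cover BB)
  (win := Gfin_win (Bs_groupable BB)) (fun V => gpI _).
have P84 : _ -> Sfin _ (Bs_groupable BB) :=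
  no_winning_strategy_selection (win := Gfin_win (Bs_groupable BB)).
have P73 : _ -> Sfin _ (I_Bs_groupable I BB) :=
  no_winning_strategy_selection (win := Gfin_win (I_Bs_groupable I BB)).
have P43 : Sfin (open_Bs_cover BB) (Bs_groupable BB) ->
    Sfin (open_Bs_cover BB) (I_Bs_groupable I BB).
  by move=> S A /S[B [BA /gpI BI]]; exists B.
have P32 := Sfin_groupable_hurewicz BB_bornology I_ideal I_pseudounion.
tfae.
- exact: P12.
- by move=> /P26/P68/P87/P73.
- by move=> /P32/P26/P68/P84.
- by move=> /P43/P32/P26/P65.
- by move=> /P51/P12/P26.
- by move=> /P68/P87.
- by move=> /P73/P32/P26/P68.
- by move=> /P84/P43/P32/P26/P65/P51.
Qed.
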